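(* Let $F$ be a field and let $L$ be a Lie algebra over $F$ whose dimension over $F$ is at most countable. Let $x \in L'$ be such that for some presentation $D$ of $x$, the corresponding weighted graph $\Gamma$ has four vertices and is defectless. Then $x \in [L,L]$.
   Context: Lie algebra notation: $[L,L] := \{[x,y] : x,y\in L\}$ is the set of commutators (not its span); $L'$ is its $F$-linear span; $Z(L)$ is the center of $L$. Weighted graphs: a weighted graph over $F$ is a finite simple graph $\Gamma=(V,E)$ with ordered vertex set $V=\{v_1,\dots,v_n\}$, where each edge $e_{i,j}$ ($i<j$) joining $v_i$ and $v_j$ carries a weight $d_{i,j}\in F$ (possibly $0$). For an edge between $v_i$ and $v_j$ with $i<j$ put $d(v_i,v_j):=d_{i,j}$ and $d(v_j,v_i):=-d_{i,j}$. Defects of a weighted graph with four vertices: - type $(4)_A$: there are distinct vertices $p_1,p_2,p_3,p_4$ such that $p_1p_2,p_1p_3,p_2p_3,p_3p_4$ are edges, $d(p_1,p_3)=d(p_2,p_3)=0$, $d(p_1,p_2)\neq0$ and $d(p_3,p_4)\ne 0$. - type $(4)_B$: there are distinct vertices $p_1,p_2,p_3,p_4$ such that $p_1p_2,p_1p_3,p_1p_4,p_2p_3,p_3p_4$ are edges, $d(p_1,p_3)=0$, the weights $d(p_1,p_2),d(p_1,p_4),d(p_2,p_3),d(p_3,p_4)$ are all nonzero, and $d(p_1,p_2)d(p_3,p_4)\neq -d(p_1,p_4)d(p_2,p_3)$. - type $(4)_C$: there are distinct vertices $p_1,p_2,p_3,p_4$, all six pairs of which are edges with nonzero weights, and $d(p_1,p_2)d(p_3,p_4)+d(p_1,p_4)d(p_2,p_3)\neq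 d(p_1,p_3)d(p_2,p_4)$. Other edges of $\Gamma$ may be present in addition to the listed ones. The graph is defectless if it has no defect of type $(4)_A$, $(4)_B$ or $(4)_C$. Presentations: let $\mathcal B_1$ be a basis of $Z(L)$, extended to a basis $\mathcal B_1\cup\mathcal B_2$ of $L$, with $\mathcal B_2=\{u_1,u_2,\dots\}$. Write $x=\sum_{1\le i<j\le r} d_{i,j}[u_i,u_j]$ with $d_{i,j}\in F$ (neither $\mathcal B_2$ nor the scalars are unique). Let $\mathcal I$ be the set of all indices $k$ such that $d_{k,j}\neq 0$ for some $j$ or $d_{i,k}\ne0$ for some $i$, and let $n=|\mathcal I|$. Permute the indices so that $\mathcal I=\{1,\dots,n\}$ (with the convention $d_{j,i}=-d_{i,j}$). The corresponding weighted graph $\Gamma$ has vertices $v_1,\dots,v_n$; $v_i$ and $v_j$ are adjacent if and only if $[u_i,u_j]\neq0$, and the edge $e_{i,j}$ ($i<j$) has weight $d_{i,j}$. The weight sequence $D=(d_{i,j})_{e_{i,j}\in E}$ so obtained (for any choice of $\mathcal B_2$, of scalars, and of permutation) is called a presentation of $x$, and $\Gamma$ is its corresponding weighted graph. *)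

(* Defs.v *)
From HB Require Import structures.
From mathcomp Require Import all_boot all_algebra.
From mathcomp Require Import classical_sets cardinality.

Set Implicit Arguments.
Unset Strict Implicit.
Unset Printing Implicit Defensive.

Import GRing.Theory.

Local Open Scope ring_scope.
Local Open Scope classical_set_scope.

HB.mixin Record Lmodule_isLieAlgebra (F : fieldType) L of GRing.Lmodule F L := {
  lie : L -> L -> L;
  lie_linearl : forall y : L, linear (fun x : L => lie x y);
  lie_linearr : forall x : L, linear (lie x);
  lie_alternating : forall x : L, lie x x = 0;
  lie_jacobi : forall x y z : L,
    lie x (lie y z) + lie y (lie z x) + lie z (lie x y) = 0
}.

#[short(type="lieAlgType")]
HB.structure Definition LieAlgebra (F : fieldType) :=
  { L of GRing.Lmodule F L & Lmodule_isLieAlgebra F L }.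

Section Bases.
Variables (F : fieldType) (V : lmodType F).
Implicit Types (S B W : set V).

Definition lin_span S : set V :=
  [set v | exists (m : nat) (a : 'I_m -> F) (w : 'I_m -> V),
     (forall i, S (w i)) /\ v = \sum_(i < m) a i *: w i].

Definition lin_indep B : Prop :=
  forall (m : nat) (a : 'I_m -> F) (w : 'I_m -> V),
    injective w -> (forall i, B (w i)) ->
    \sum_(i < m) a i *: w i = 0 -> forall i, a i = 0.

Definition is_basis W B : Prop := lin_indep B /\ lin_span B = W.

End Bases.

Definition countable_dim (F : fieldType) (V : lmodType F) : Prop :=
  exists B : set V, is_basis [set: V] B /\ countable B.

Section LieSets.
Variables (F : fieldType) (L : lieAlgType F).

(* A set of commutators, in general not a subspace. *)
Definition commutators : set L := [set z | exists x y : L, z = lie x y].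

Definition derived : set L := lin_span commutators.

Definition center : set L := [set z | forall y : L, lie z y = 0].

End LieSets.

Arguments commutators {F} L.
Arguments derived {F} L.
Arguments center {F} L.

(* The values of wt matter only at the pairs i < j that are edges. *)
Record wgraph (F : fieldType) (n : nat) := WGraph {
  adj : rel 'I_n;
  adj_sym : symmetric adj;
  adj_irrefl : irreflexive adj;
  wt : 'I_n -> 'I_n -> F
}.

Section Defects.
Variable F : fieldType.

Definition gwt (n : nat) (G : wgraph F n) (p q : 'I_n) : F :=
  if (p < q)%N then wt G p q else - wt G q p.

Variable G : wgraph F 4.

Local Notation e := (adj G).
Local Notation d := (gwt G).

Definition defect4A : Prop :=
  exists p1 p2 p3 p4 : 'I_4,
    [/\ uniq [:: p1; p2; p3; p4],
        [/\ e p1 p2, e p1 p3, e p2 p3 & e p3 p4],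
        d p1 p3 = 0 /\ d p2 p3 = 0 &
        d p1 p2 != 0 /\ d p3 p4 != 0].

Definition defect4B : Prop :=
  exists p1 p2 p3 p4 : 'I_4,
    [/\ uniq [:: p1; p2; p3; p4],
        [/\ e p1 p2, e p1 p3, e p1 p4, e p2 p3 & e p3 p4],
        d p1 p3 = 0,
        [/\ d p1 p2 != 0, d p1 p4 != 0, d p2 p3 != 0 & d p3 p4 != 0] &
        d p1 p2 * d p3 p4 != - (d p1 p4 * d p2 p3)].

Definition defect4C : Prop :=
  exists p1 p2 p3 p4 : 'I_4,
    [/\ uniq [:: p1; p2; p3; p4],
        forall p q : 'I_4, p != q -> e p q /\ d p q != 0 &
        d p1 p2 * d p3 p4 + d p1 p4 * d p2 p3 != d p1 p3 * d p2 p4].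

Definition defectless : Prop := [/\ ~ defect4A, ~ defect4B & ~ defect4C].

End Defects.

Section Presentations.
Variables (F : fieldType) (L : lieAlgType F).

Definition skew (d : nat -> nat -> F) (i j : nat) : F :=
  if (i < j)%N then d i j else if (j < i)%N then - d j i else 0.

Definition used_indices (r : nat) (d : nat -> nat -> F) : set nat :=
  [set k | (exists j, [/\ (k < j)%N, (j < r)%N & d k j != 0]) \/
           (exists i, [/\ (i < k)%N, (k < r)%N & d i k != 0])].

(* Indices start at 0.  The u_k are indexed by an initial segment pK of nat,
   finite or not; values of pu outside pK, and of pd outside i < j < pr, are
   irrelevant.  The map psigma is the renumbering of the used indices by
   0, ..., n - 1. *)
Record presentation (x : L) (n : nat) := Presentation {
  pB1 : set L;
  pK : set nat;
  pu : nat -> L;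
  pr : nat;
  pd : nat -> nat -> F;
  psigma : 'I_n -> nat;
  pB1_basis : is_basis (center L) pB1;
  pK_segment : pK = [set: nat] \/ exists m : nat, pK = `I_m;
  pu_inj : {in pK &, injective pu};
  pB12_disjoint : pB1 `&` (pu @` pK) = set0;
  pB12_basis : is_basis [set: L] (pB1 `|` (pu @` pK));
  pr_le : `I_pr `<=` pK;
  p_eq : x = \sum_(j < pr) \sum_(i < pr | (i < j)%N) pd i j *: lie (pu i) (pu j);
  psigma_inj : injective psigma;
  psigma_used : range psigma = used_indices pr pd
}.

Variables (x : L) (n : nat) (D : presentation x n).

Definition pres_adj : rel 'I_n :=
  fun i j => lie (pu D (psigma D i)) (pu D (psigma D j)) != 0.

Lemma lie_antisym (y z : L) : lie y z = - lie z y.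
Proof.
have addl (a b c : L) : lie (a + b) c = lie a c + lie b c.
  by have := lie_linearl c 1 a b; rewrite !scale1r.
have addr (a b c : L) : lie c (a + b) = lie c a + lie c b.
  by have := lie_linearr c 1 a b; rewrite !scale1r.
have := lie_alternating (y + z).
rewrite addl !addr !lie_alternating add0r addr0 => /eqP.
by rewrite addr_eq0 => /eqP.
Qed.

Lemma pres_adj_sym : symmetric pres_adj.
Proof. by move=> i j; rewrite /pres_adj lie_antisym oppr_eq0. Qed.

Lemma pres_adj_irrefl : irreflexive pres_adj.
Proof. by move=> i; rewrite /pres_adj lie_alternating eqxx. Qed.

Definition pres_graph : wgraph F n :=
  WGraph pres_adj_sym pres_adj_irrefl
         (fun i j => skew (pd D) (psigma D i) (psigma D j)).

End Presentations.

(* Main.v *)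
(** A sum of brackets over four vectors is the image of a bivector of a
    4-dimensional space, and it is a commutator as soon as the Pfaffian
    [d12 d34 - d13 d24 + d14 d23] vanishes, for then the bivector is
    decomposable.  The weights of non-edges may be changed freely.  If this does
    not suffice to kill the Pfaffian, then every non-edge is opposite to an edge
    of weight 0, so the Pfaffian has one, two or three nonzero terms, all of
    them products of weights of opposite edges; absence of the defects
    (4)_A, (4)_B, (4)_C respectively excludes that the sum is nonzero. *)
Require Import Defs.
From HB Require Import structures.
From mathcomp Require Import all_boot all_algebra.
From mathcomp Require Import classical_sets cardinality.
From mathcomp Require Import ring.

Set Implicit Arguments.
Unset Strict Implicit.
Unset Printing Implicit Defensive.

Import GRing.Theory.
Local Open Scope ring_scope.

(** * Combinations of six brackets and their Pfaffian *)

Section LieBilinear.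
Variables (F : fieldType) (L : lieAlgType F).
Implicit Types (x y z : L) (k : F).

Lemma lieDl x y z : lie (x + y) z = lie x z + lie y z.
Proof. by have := lie_linearl z 1 x y; rewrite !scale1r. Qed.

Lemma lieDr x y z : lie z (x + y) = lie z x + lie z y.
Proof. by have := lie_linearr z 1 x y; rewrite !scale1r. Qed.

Lemma lie0l z : lie 0 z = 0.
Proof. by apply: (addrI (lie 0 z)); rewrite -lieDl !addr0. Qed.

Lemma lie0r z : lie z 0 = 0.
Proof. by rewrite lie_antisym lie0l oppr0. Qed.

Lemma lieZl k x z : lie (k *: x) z = k *: lie x z.
Proof. by have := lie_linearl z k x 0; rewrite lie0l !addr0. Qed.

Lemma lieZr k x z : lie z (k *: x) = k *: lie z x.
Proof. by have := lie_linearr z k x 0; rewrite lie0r !addr0. Qed.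

Definition lie_comb4 (u1 u2 u3 u4 : L) (d12 d13 d14 d23 d24 d34 : F) : L :=
  d12 *: lie u1 u2 + d13 *: lie u1 u3 + d14 *: lie u1 u4
  + d23 *: lie u2 u3 + d24 *: lie u2 u4 + d34 *: lie u3 u4.

(** The six coefficients are the 2 x 2 minors of the coordinate rows [(1, 0, k, l)] and
    [(0, a, b, c)]. *)
Lemma lie_comb4E u1 u2 u3 u4 (a b c k l : F) :
  lie (u1 + k *: u3 + l *: u4) (a *: u2 + b *: u3 + c *: u4)
  = lie_comb4 u1 u2 u3 u4 a b c (- (k * a)) (- (l * a)) (k * c - l * b).
Proof.
rewrite /lie_comb4 !lieDl !lieDr !lieZl !lieZr !lie_alternating !scaler0.
rewrite (lie_antisym u3 u2) (lie_antisym u4 u2) (lie_antisym u4 u3).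
rewrite !scalerN !scalerA !scalerBl !scaleNr !addrA.
by rewrite !addr0 [LHS](ACl (1*2*3*4*6*5*7)%AC).
Qed.

(** In the normal form above, [a], [b], [c] are read off directly, [d] and [e] determine [k] and [l]
    after division by [a], and the Pfaffian relation then forces [f]. *)
Lemma lie_comb4_ne0 u1 u2 u3 u4 (a b c d e f : F) :
  a != 0 -> a * f - b * e + c * d = 0 ->
  commutators L (lie_comb4 u1 u2 u3 u4 a b c d e f).
Proof.
move=> a0 pf.
exists (u1 + (- d / a) *: u3 + (- e / a) *: u4), (a *: u2 + b *: u3 + c *: u4).
rewrite lie_comb4E; congr (lie_comb4 _ _ _ _ _ _ _ _ _ _); try by field.
apply: (mulfI a0); apply/eqP; rewrite -subr_eq0 -pf; apply/eqP; by field.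
Qed.

Lemma lie_comb4_commutator u1 u2 u3 u4 (a b c d e f : F) :
  a * f - b * e + c * d = 0 ->
  commutators L (lie_comb4 u1 u2 u3 u4 a b c d e f).
Proof.
move=> pf.
have sw k x y : - k *: lie x y = k *: lie y x.
  by rewrite (lie_antisym x y) scalerN scaleNr opprK.
(* A permutation of the four vectors multiplies the Pfaffian by its sign, so any nonzero coefficient
   can be moved to the first position. *)
have reorder v1 v2 v3 v4 a' b' c' d' e' f' :
    a' != 0 -> a' * f' - b' * e' + c' * d' = a * f - b * e + c * d \/
               a' * f' - b' * e' + c' * d' = - (a * f - b * e + c * d) ->
    lie_comb4 u1 u2 u3 u4 a b c d e f
      = lie_comb4 v1 v2 v3 v4 a' b' c' d' e' f' ->
    commutators L (lie_comb4 u1 u2 u3 u4 a b c d e f).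
  move=> a0' pf' ->; apply: lie_comb4_ne0 => //.
  by case: pf' => ->; rewrite pf ?oppr0.
have [a0|] := eqVneq a 0; last by move=> *; apply: lie_comb4_ne0.
have [b0|nb] := eqVneq b 0; last first.
  apply: (reorder u1 u3 u2 u4 b a c (- d) f e) => //; first by right; ring.
  by rewrite /lie_comb4 sw [LHS](ACl (2*1*3*4*6*5)%AC).
have [c0|nc] := eqVneq c 0; last first.
  apply: (reorder u1 u4 u2 u3 c a b (- e) (- f) d) => //; first by left; ring.
  by rewrite /lie_comb4 !sw [LHS](ACl (3*1*2*5*6*4)%AC).
have [d0|nd] := eqVneq d 0; last first.
  apply: (reorder u2 u3 u1 u4 d (- a) e (- b) f c) => //; first by left; ring.
  by rewrite /lie_comb4 !sw [LHS](ACl (4*1*5*2*6*3)%AC).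
have [e0|ne] := eqVneq e 0; last first.
  apply: (reorder u2 u4 u1 u3 e (- a) d (- c) (- f) b) => //; first by right; ring.
  by rewrite /lie_comb4 !sw [LHS](ACl (5*1*4*3*6*2)%AC).
have [f0|nf] := eqVneq f 0; last first.
  apply: (reorder u3 u4 u1 u2 f (- b) (- d) (- c) (- e) a) => //; first by left; ring.
  by rewrite /lie_comb4 !sw [LHS](ACl (6*2*4*3*5*1)%AC).
exists 0, 0; rewrite lie0l /lie_comb4 a0 b0 c0 d0 e0 f0 !scale0r.
by rewrite !addr0.
Qed.

End LieBilinear.

(** * Classification of pairs of opposite vertex pairs *)

Section OppositePairs.
Variable F : fieldType.

(* A pair of opposite vertex pairs, with edge flags [e], [e'] and weights
   [a], [a'].  In the first case the product of the weights can be given any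
   value by changing the weights of non-edges. *)
Variant opposite_spec (e e' : bool) (a a' : F) : Prop :=
| OppositeFree of (forall t : F, exists b b' : F,
    [/\ e -> b = a, e' -> b' = a' & b * b' = t])
| OppositeZero of (e && (a == 0)) || (e' && (a' == 0))
| OppositeFull of e & e' & a != 0 & a' != 0.

Lemma oppositeP e e' a a' : opposite_spec e e' a a'.
Proof.
have [ea|nea] := boolP (e && (a == 0)); first by apply: OppositeZero; rewrite ea.
have [ea'|nea'] := boolP (e' && (a' == 0)).
  by apply: OppositeZero; rewrite ea' orbT.
case: e nea => /= [na|_]; case: e' nea' => /= [na'|_]; first exact: OppositeFull.
- by apply: OppositeFree => t; exists a, (a^-1 * t); rewrite mulVKf.
- by apply: OppositeFree => t; exists (t / a'), a'; rewrite divfK.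
- by apply: OppositeFree => t; exists t, 1; rewrite mulr1.
Qed.

End OppositePairs.

Local Ltac uniq4 := rewrite /= !inE !negb_or; do !(apply/andP; split).

(** * Killing the Pfaffian of a defectless graph *)

Section DefectlessPfaffian.
Variables (F : fieldType) (G : wgraph F 4).
Hypotheses (G_defectless : defectless G)
  (gwtN : forall p q : 'I_4, p != q -> gwt G q p = - gwt G p q).
Local Notation e := (adj G).
Local Notation d := (gwt G).
Implicit Types p q r s : 'I_4.

Definition zero_edge p q := e p q && (d p q == 0).

Lemma zero_edgeC p q : p != q -> zero_edge p q = zero_edge q p.
Proof. by move=> pq; rewrite /zero_edge adj_sym (gwtN pq) oppr_eq0. Qed.

(** The two zero edges come from different opposite pairs, so they share a vertex. Their other ends
    are joined by one of the edges [pq], [rs], and the other one leaves the shared vertex: this is a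
    defect (4)_A. *)
Lemma no_single_product p q r s : uniq [:: p; q; r; s] ->
  e p q -> e r s -> d p q != 0 -> d r s != 0 ->
  zero_edge p r || zero_edge q s -> zero_edge p s || zero_edge q r -> False.
Proof.
move=> U epq ers npq nrs.
have [nA _ _] := G_defectless.
have A p1 p2 p3 p4 : uniq [:: p1; p2; p3; p4] -> e p1 p2 -> e p3 p4 ->
    d p1 p2 != 0 -> d p3 p4 != 0 -> zero_edge p1 p3 -> zero_edge p2 p3 -> False.
  move=> U' e12 e34 n12 n34 /andP[e13 /eqP d13] /andP[e23 /eqP d23].
  by apply: nA; exists p1, p2, p3, p4.
have [epq' ers'] : e q p /\ e s r by rewrite ![e q _]adj_sym ![e s _]adj_sym.
move: (U); rewrite /= !inE !negb_or.
case/and4P=> /and3P[pq pr ps] /andP[qr qs] rs _.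
have [npq' nrs'] : d q p != 0 /\ d s r != 0 by rewrite (gwtN pq) (gwtN rs) !oppr_eq0.
have [qp rp sp] : [/\ q != p, r != p & s != p].
  by split; rewrite eq_sym.
have [rq sq sr] : [/\ r != q, s != q & s != r].
  by split; rewrite eq_sym.
case/orP=> z1 /orP[] z2.
- by apply: (A r s p q) => //; first (by uniq4); rewrite zero_edgeC.
- exact: (A p q r s).
- by apply: (A p q s r) => //; uniq4.
- by apply: (A r s q p) => //; first (by uniq4); rewrite zero_edgeC.
Qed.

(** The vertices form a 4-cycle with nonzero weights and a diagonal of weight 0; if the sum were
    nonzero, this would be a defect (4)_B. *)
Lemma two_products_cancel p q r s : uniq [:: p; q; r; s] ->
  zero_edge p r || zero_edge q s ->
  e p q -> e r s -> d p q != 0 -> d r s != 0 ->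
  e p s -> e q r -> d p s != 0 -> d q r != 0 ->
  d p q * d r s + d p s * d q r = 0.
Proof.
move=> U z epq ers npq nrs eps eqr nps nqr.
have [_ nB _] := G_defectless.
apply/eqP; rewrite addr_eq0; apply/negPn/negP => neq.
move: (U); rewrite /= !inE !negb_or.
case/and4P=> /and3P[pq pr ps] /andP[qr qs] rs _.
apply: nB; case/orP: z => /andP[ez /eqP dz].
  by exists p, q, r, s.
have esp : e s p by rewrite adj_sym.
(* Rotating the cycle puts the zero diagonal [qs] in the place of [p1p3]. One weight in each product
   is reversed, so the inequality is preserved. *)
exists q, r, s, p; split=> //; first by rewrite -(rot_uniq 3).
- by split=> //; rewrite adj_sym.
- by split=> //; rewrite ?(gwtN pq) ?(gwtN ps) ?oppr_eq0.
- rewrite (gwtN ps) (gwtN pq) mulrN mulNr opprK.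
  by rewrite [d q r * _]mulrC eq_sym.
Qed.

Lemma defectless_pfaffian p q r s : uniq [:: p; q; r; s] ->
  exists a b c k l m : F,
    [/\ [/\ e p q -> a = d p q, e p r -> b = d p r & e p s -> c = d p s],
        [/\ e q r -> k = d q r, e q s -> l = d q s & e r s -> m = d r s] &
        a * m - b * l + c * k = 0].
Proof.
move=> U.
move: (U); rewrite /= !inE !negb_or.
case/and4P=> /and3P[pq pr ps] /andP[qr qs] rs _.
have [rq sr sq] : [/\ r != q, s != r & s != q].
  by split; rewrite eq_sym.
have [U1324 U1243 U1423] : [/\ uniq [:: p; r; q; s], uniq [:: p; q; s; r] &
    uniq [:: p; s; q; r]] by split; uniq4.
have sym x y : x != y -> (e x y -> e y x) * (d x y != 0 -> d y x != 0).
  by move=> xy; rewrite adj_sym (gwtN xy) oppr_eq0.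
have pf_d : d p q * d r s - d p r * d q s + d p s * d q r = 0 ->
  exists a b c k l m : F,
    [/\ [/\ e p q -> a = d p q, e p r -> b = d p r & e p s -> c = d p s],
        [/\ e q r -> k = d q r, e q s -> l = d q s & e r s -> m = d r s] &
        a * m - b * l + c * k = 0].
  by exists (d p q), (d p r), (d p s), (d q r), (d q s), (d r s).
have zero_product x y z t : zero_edge x y || zero_edge z t -> d x y * d z t = 0.
  by case/orP=> /andP[_ /eqP->]; rewrite ?mul0r ?mulr0.
(* As soon as one opposite pair is free, its product is chosen to balance the other two terms, which
   keep their given weights. *)
case: (oppositeP (e p q) (e r s) (d p q) (d r s)) => [fr1|z1|e1 e1' n1 n1'].
  have [a [m [ea em am]]] := fr1 (d p r * d q s - d p s * d q r).
  by exists a, (d p r), (d p s), (d q r), (d q s), m; split=> //; ring: am.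
all: case: (oppositeP (e p r) (e q s) (d p r) (d q s)) => [fr2|z2|e2 e2' n2 n2'].
1,4: have [b [l [eb el bl]]] := fr2 (d p q * d r s + d p s * d q r);
  by exists (d p q), b, (d p s), (d q r), l, (d r s); split=> //; ring: bl.
all: case: (oppositeP (e p s) (e q r) (d p s) (d q r)) => [fr3|z3|e3 e3' n3 n3'].
1,4,7,10: have [c [k [ec ek ck]]] := fr3 (d p r * d q s - d p q * d r s);
  by exists (d p q), (d p r), c, k, (d q s), (d r s); split=> //; ring: ck.
(* No pair is free any more, and the given weights already have Pfaffian 0. The eight cases record
   which pairs contain a zero edge and which are full. *)
all: apply: pf_d.
- by rewrite !zero_product // subrr addr0.
- have [] := no_single_product U1423 e3 e3' n3 n3'.
    by rewrite [zero_edge s r]zero_edgeC.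
  by rewrite [zero_edge s q]zero_edgeC.
- have [] := no_single_product U1324 e2 e2' n2 n2' z1.
  by rewrite [zero_edge r q]zero_edgeC.
(* The vertices are ordered so that the pair with the zero edge gives the diagonals of the cycle;
   reversing [qr] produces the signs of the Pfaffian. *)
- have := two_products_cancel U1324 z1 e2 e2' n2 n2' e3 ((sym _ _ qr).1 e3')
    n3 ((sym _ _ qr).2 n3').
  rewrite (gwtN qr) (zero_product _ _ _ _ z1) => /eqP.
  by rewrite addr_eq0 => /eqP ->; ring.
- by have [] := no_single_product U e1 e1' n1 n1' z2 z3.
- have := two_products_cancel U z2 e1 e1' n1 n1' e3 e3' n3 n3'.
  by rewrite (zero_product _ _ _ _ z2) subr0.
- have := two_products_cancel U1243 z3 e1 ((sym _ _ rs).1 e1') n1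
    ((sym _ _ rs).2 n1') e2 e2' n2 n2'.
  rewrite (gwtN rs) (zero_product _ _ _ _ z3) => /eqP.
  by rewrite addr_eq0 mulrN eqr_opp => /eqP ->; ring.
- have [_ _ nC] := G_defectless.
  apply/eqP/negPn/negP => pf; apply: nC; exists p, q, r, s; split=> //; last first.
    by apply: contraNneq pf => h; rewrite addrAC h subrr.
  have all4 u : u \in [:: p; q; r; s].
    rewrite (subset_cardP _ (subset_predT _)) //.
    by rewrite (card_uniqP U) card_ord.
  move=> u v; move: (all4 u) (all4 v); rewrite !inE.
  by case/or4P=> /eqP-> /or4P[] /eqP->; rewrite ?eqxx // => uv;
    split; do ?[done | by apply: (sym _ _ _).1 | by apply: (sym _ _ _).2].
Qed.

End DefectlessPfaffian.

(** * Renumbering sums along an injection that covers the support *)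

Lemma sum_over_support (V : zmodType) (n r : nat) (sigma : 'I_n -> nat)
    (g : nat -> V) :
  injective sigma -> (forall p, (sigma p < r)%N) ->
  (forall i, (i < r)%N -> g i != 0 -> exists p, sigma p = i) ->
  \sum_(i < r) g i = \sum_p g (sigma p).
Proof.
move=> sinj sr sg; pose s p := Ordinal (sr p).
rewrite (bigID (mem (s @: 'I_n))) /= [X in _ + X]big1 => [|i ni]; last first.
  apply/eqP; apply: contraNT ni => /(sg _ (ltn_ord i))[p pi].
  by apply/imsetP; exists p => //; apply: ord_inj.
rewrite addr0 big_imset /=; last by move=> p q _ _ [] /sinj.
by apply: eq_bigl => p; rewrite inE.
Qed.

(* Both sums run over unordered pairs, although [sigma] need not be increasing. *)
Lemma sum_pairs_over_support (V : zmodType) (n r : nat) (sigma : 'I_n -> nat)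
    (f : nat -> nat -> V) :
  injective sigma -> (forall p, (sigma p < r)%N) ->
  (forall i j, f i j = f j i) ->
  (forall i j, (i < r)%N -> (j < r)%N -> f i j != 0 -> exists p, sigma p = i) ->
  \sum_(j < r) \sum_(i < r | (i < j)%N) f i j
  = \sum_(q < n) \sum_(p < n | (p < q)%N) f (sigma p) (sigma q).
Proof.
move=> sinj sr fC fs.
transitivity (\sum_q \sum_p
    (if (sigma p < sigma q)%N then f (sigma p) (sigma q) else 0)).
  pose g i j := if (i < j)%N then f i j else 0.
  transitivity (\sum_(j < r) \sum_(i < r) g i j).
    by apply: eq_bigr => j _; rewrite big_mkcond.
  have gs i j : (i < r)%N -> (j < r)%N -> g i j != 0 -> exists p, sigma p = i.
    by rewrite /g; case: ifP; rewrite ?eqxx // => _; apply: fs.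
  rewrite (@sum_over_support _ n r sigma (fun j => \sum_(i < r) g i j)) //.
    apply: eq_bigr => q _; rewrite (@sum_over_support _ n r sigma (g^~ _)) //.
    by move=> i ir; apply: gs.
  move=> j jr nz; have [i gij] : exists i : 'I_r, g i j != 0.
    apply/existsP; apply: contraR nz; rewrite negb_exists => /forallP g0.
    by rewrite big1 // => i _; apply/eqP/negPn/g0.
  move: gij; rewrite /g; case: ifP; rewrite ?eqxx // => _.
  by rewrite fC; apply: fs.
(* The ordered pairs are split by [p < q] and [q < p], the diagonal contributing 0. The second half
   is then transposed by symmetry of [f]; since [sigma p] and [sigma q] differ, exactly one half
   contributes for each [p < q]. *)
rewrite (eq_bigr (fun q : 'I_n =>
    \sum_(p < n | (p < q)%N) (if (sigma p < sigma q)%N then f (sigma p) (sigma q) else 0)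
  + \sum_(p < n | (q < p)%N) (if (sigma p < sigma q)%N then f (sigma p) (sigma q) else 0)));
  last first.
  move=> q _; rewrite (bigID (fun p : 'I_n => (p < q)%N)) /=; congr (_ + _).
  rewrite (bigID (fun p : 'I_n => (q < p)%N)) /= [X in _ + X]big1 ?addr0.
    by apply: eq_bigl => p; rewrite -leqNgt; case: ltngtP.
  move=> p; rewrite -!leqNgt -eqn_leq => /eqP qp.
  by rewrite (ord_inj qp) ltnn.
rewrite big_split /=.
have -> : \sum_(q < n) \sum_(p < n | (q < p)%N)
    (if (sigma p < sigma q)%N then f (sigma p) (sigma q) else 0)
  = \sum_(q < n) \sum_(p < n | (p < q)%N)
    (if (sigma q < sigma p)%N then f (sigma p) (sigma q) else 0).
  rewrite (exchange_big_dep predT) //=; apply: eq_bigr => q _.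
  by apply: eq_bigr => p _; rewrite fC.
rewrite -big_split; apply: eq_bigr => q _ /=.
rewrite -big_split; apply: eq_bigr => p pq /=.
have : sigma p != sigma q by rewrite (inj_eq sinj) neq_ltn pq.
by case: ltngtP => //; rewrite ?addr0 ?add0r.
Qed.

(** * Recovering the element from its weighted graph *)

Section PresentationGraph.
Variables (F : fieldType) (L : lieAlgType F) (x : L) (n : nat).
Variable D : presentation x n.

Lemma pres_gwtE p q : p != q ->
  gwt (pres_graph D) p q = Defs.skew (pd D) (psigma D p) (psigma D q).
Proof.
move=> pq; rewrite /gwt /=; case: ifP => // pq'.
have : psigma D p != psigma D q by rewrite (inj_eq (@psigma_inj _ _ _ _ D)).
by rewrite /Defs.skew; case: ltngtP => //; rewrite opprK.
Qed.

Lemma pres_gwtN p q : p != q ->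
  gwt (pres_graph D) q p = - gwt (pres_graph D) p q.
Proof.
move=> pq; rewrite !pres_gwtE // 1?eq_sym //.
by rewrite /Defs.skew; case: ltngtP; rewrite ?opprK ?oppr0.
Qed.

Lemma pres_sum_gwt :
  x = \sum_(q < n) \sum_(p < n | (p < q)%N) gwt (pres_graph D) p q
        *: lie (pu D (psigma D p)) (pu D (psigma D q)).
Proof.
(* Extending the scalars skew-symmetrically makes each term symmetric in [i] and [j], as the bracket
   is antisymmetric too; hence the renumbering may reverse pairs. *)
pose f i j := Defs.skew (pd D) i j *: lie (pu D i) (pu D j).
have used k : used_indices (pr D) (pd D) k <-> exists p, psigma D p = k.
  rewrite -psigma_used; split; last by case=> p <-; exists p.
  by case=> p _ <-; exists p.
rewrite {1}(p_eq D).
transitivity (\sum_(j < pr D) \sum_(i < pr D | (i < j)%N) f i j).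
  by apply: eq_bigr => j _; apply: eq_bigr => i ij; rewrite /f /Defs.skew ij.
rewrite (sum_pairs_over_support (@psigma_inj _ _ _ _ D)).
- apply: eq_bigr => q _; apply: eq_bigr => p pq.
  by rewrite pres_gwtE // neq_ltn pq.
- move=> p; have [_ /(_ (ex_intro _ p erefl))] := used (psigma D p).
  by case=> [[j [kj jr _]]|[i [_ kr _]]] //; apply: ltn_trans jr.
- move=> i j; rewrite /f (lie_antisym (pu D i)) scalerN -scaleNr.
  by congr (_ *: _); rewrite /Defs.skew; case: ltngtP; rewrite ?opprK ?oppr0.
move=> i j ir jr; rewrite /f scaler_eq0 negb_or => /andP[nz _].
apply/used; move: nz; rewrite /Defs.skew; case: ltngtP => [ij nz|ji nz|_].
- by left; exists j.
- by right; exists j; split=> //; rewrite -oppr_eq0.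
- by rewrite eqxx.
Qed.

End PresentationGraph.

Theorem theorem1p2 (F : fieldType) (L : lieAlgType F)
  (hL : countable_dim L) (x : L) (hx : derived L x)
  (hD : exists D : presentation x 4, defectless (pres_graph D)) :
  commutators L x.
Proof.
case: hD => D hD.
pose o0 := @Ordinal 4 0 isT; pose o1 := @Ordinal 4 1 isT.
pose o2 := @Ordinal 4 2 isT; pose o3 := @Ordinal 4 3 isT.
have [a [b [c [k [l [m [[ha hb hc] [hk hl hm] pf]]]]]]] :=
  @defectless_pfaffian _ _ hD (@pres_gwtN _ _ _ _ D) o0 o1 o2 o3 isT.
pose u p := pu D (psigma D p).
have -> : x = lie_comb4 (u o0) (u o1) (u o2) (u o3) a b c k l m.
  (* A non-edge means a vanishing bracket, so its weight can be replaced without changing [x]. *)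
  have edgeE p q t : (adj (pres_graph D) p q -> t = gwt (pres_graph D) p q) ->
      gwt (pres_graph D) p q *: lie (u p) (u q) = t *: lie (u p) (u q).
    rewrite /= /pres_adj -!/(u _).
    by have [->|_ ->] := eqVneq (lie (u p) (u q)) 0; rewrite ?scaler0.
  rewrite /lie_comb4 -(edgeE _ _ _ ha) -(edgeE _ _ _ hb) -(edgeE _ _ _ hc).
  rewrite -(edgeE _ _ _ hk) -(edgeE _ _ _ hl) -(edgeE _ _ _ hm).
  have sum4 (g : 'I_4 -> L) : \sum_p g p = g o0 + g o1 + g o2 + g o3.
    rewrite !big_ord_recr big_ord0 /= add0r.
    by congr (g _ + g _ + g _ + g _); apply: val_inj.
  rewrite {1}(pres_sum_gwt D) sum4 !(big_mkcond (fun p : 'I_4 => (p < _)%N)) !sum4 /=.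
  by rewrite !addr0 !add0r !addrA [LHS](ACl (1*2*4*3*5*6)%AC).
exact: lie_comb4_commutator.
Qed.
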